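(* The number of training measurements required by the graph-coloring experiment design described in the context (with $\bar T=\bar rD$) is $$T_{\mathrm{tr}}=\bar r D\left\lceil\frac{\mathrm{NumColors}}{D-1}\right\rceil,\qquad\text{where } \mathrm{NumColors}\le \mathrm{Degree}(\mathcal G')+1 .$$ As a result, $T_{\mathrm{tr}}\le\dfrac{\bar rD(d^2+D)}{D-1}$, where $d$ is the maximum degree of $\mathcal G$.
   Context: $[X]=\{1,\dots,X\}$. There are $N$ units and $D\ge2$ treatments; $\mathcal G=([N],\mathcal E)$ is an undirected graph in which every self-edge is included by convention; degrees (both $d$ and $\mathrm{Degree}(\cdot)$, the maximum degree of a graph) do not count self-edges. Experiment design (parameter $\bar r\in\mathbb N_{>0}$): Let $\mathcal G'$ be the graph on $[N]$ joining distinct $i,k$ whenever $(i,k)\in\mathcal E$ or $(i,j),(j,k)\in\mathcal E$ for some $j$. Properly color $\mathcal G'$ greedily (adding a new color only when no existing color can be used), giving NumColors colors and $\mathrm{Coloring}\in[\mathrm{NumColors}]^N$. Let $T'=\lceil \mathrm{NumColors}/(D-1)\rceil$ and partition the colors into consecutive sets $\mathrm{Colors}_0,\dots,\mathrm{Colors}_{T'-1}$ of $D-1$ colors each (the last possibly fewer). For $\ell=0,\dots,T'-1$ let $c^\ell\in[D]^N$ be $c^\ell_i=(\mathrm{Coloring}_i \bmod (D-1))+2$ if $\mathrm{Coloring}_i\in\mathrm{Colors}_\ell$ and $c^\ell_i=1$ otherwise. Partition the training measurements into $T'$ disjoint sets $\mathcal T^\ell_{\mathrm{tr}}$, each of size $\bar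 T$, so that $T_{\mathrm{tr}}=\bar TT'$, and assign treatment vector $c^\ell$ at every $t\in\mathcal T^\ell_{\mathrm{tr}}$. The design takes $\bar T=\bar rD$. *)

(* Defs.v *)
From mathcomp Require Import all_boot all_order all_algebra.

Set Implicit Arguments.
Unset Strict Implicit.
Unset Printing Implicit Defensive.

Import Order.TTheory GRing.Theory Num.Theory.

Section Graphs.
Variable V : finType.

(* Self-edges are never counted, so this is also the degree of a graph in
   which every vertex carries a self-edge. *)
Definition degree (e : rel V) (i : V) : nat := #|[set j | (j != i) && e i j]|.

Definition max_degree (e : rel V) : nat := \max_(i : V) degree e i.

Definition square_graph (e : rel V) : rel V :=
  fun i k => (i != k) && (e i k || [exists j, e i j && e j k]).

(* Colors are 1, 2, ...; in a partial coloring the value 0 means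
   "not colored yet". *)
Definition available (g : rel V) (c : {ffun V -> nat}) (i : V) (x : nat) : bool :=
  [forall j, g i j ==> (c j != x)].

Definition assign_color (c : {ffun V -> nat}) (i : V) (x : nat) : {ffun V -> nat} :=
  [ffun j => if j == i then x else c j].

(* [greedy_run g c k]: some run of the greedy procedure reaches the partial
   coloring [c] with the colors 1, ..., k created so far. Neither the order in
   which the vertices are visited nor the choice among several available
   existing colors is prescribed. *)
Inductive greedy_run (g : rel V) : {ffun V -> nat} -> nat -> Prop :=
| greedy_start : greedy_run g [ffun=> 0] 0
| greedy_reuse c k i x :
    greedy_run g c k -> c i = 0 -> 0 < x <= k -> available g c i x ->
    greedy_run g (assign_color c i x) k
| greedy_new c k i :
    greedy_run g c k -> c i = 0 ->
    (forall x, 0 < x <= k -> ~~ available g c i x) ->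
    greedy_run g (assign_color c i k.+1) k.+1.

Definition greedy_coloring (g : rel V) (c : {ffun V -> nat}) (k : nat) : Prop :=
  greedy_run g c k /\ (forall i, c i != 0).

End Graphs.

(* T'. The ceiling is nonnegative for D >= 2, so the absolute value only
   converts it to a natural number. *)
Definition num_blocks (K D : nat) : nat :=
  `|Num.ceil ((K%:R / (D%:R - 1))%R : rat)|%N.

(* Colors_l: the colors l(D-1)+1, ..., min((l+1)(D-1), K). *)
Definition color_block (K D l : nat) : pred nat :=
  fun x => (l * (D - 1) < x <= l.+1 * (D - 1)) && (x <= K).

(* c^l, with the treatments numbered 1, ..., D. *)
Definition treatment (N K D : nat) (col : {ffun 'I_N -> nat}) (l : nat) :
    {ffun 'I_N -> nat} :=
  [ffun i => if color_block K D l (col i) then col i %% (D - 1) + 2 else 1].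

(* The training measurements are indexed by 'I_T; [block l] is the l-th set of
   measurements and [W t] the treatment vector used at measurement t. *)
Record training_design (N D Tbar K : nat) (col : {ffun 'I_N -> nat}) (T : nat)
    (block : 'I_(num_blocks K D) -> {set 'I_T})
    (W : 'I_T -> {ffun 'I_N -> nat}) : Prop := TrainingDesign {
  block_cover : \bigcup_l block l = [set: 'I_T];
  block_disjoint : forall l l', l != l' -> [disjoint block l & block l'];
  block_size : forall l, #|block l| = Tbar;
  block_treatment : forall l t, t \in block l -> W t = treatment K D col l }.

(* Main.v *)
(* In a greedy run a new color is created at a vertex only when each of the
   existing colors occurs among its neighbors, so at most Degree colors exist at
   that moment. A vertex has at most [d ^ 2] neighbors in [square_graph e],
   because every neighbor [j] of [i] in [e] accounts for at most [d] of them: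
   itself and its own neighbors other than [i]. The final estimate is then
   [ceil x < x + 1]. *)
Require Import Defs.
From mathcomp Require Import all_boot all_order all_algebra.

Import Order.TTheory GRing.Theory Num.Theory.
Local Open Scope ring_scope.

Lemma degree_le_max (V : finType) (e : rel V) (i : V) :
  (degree e i <= max_degree e)%N.
Proof. exact: (leq_bigmax i). Qed.

Lemma greedy_run_colors (V : finType) (g : rel V) (c : {ffun V -> nat}) (k : nat) :
  greedy_run g c k -> (k <= (max_degree g).+1)%N.
Proof.
elim=> // {}c {}k i _ _ ci0 full; rewrite ltnS.
apply: leq_trans (degree_le_max _ g i).
(* The list [1, ..., k] is duplicate-free, so it suffices that each of its entries occurs among the
   colors of the neighbors of [i]. *)
rewrite /degree cardE -(size_map c) -(size_iota 1 k).
apply: uniq_leq_size (iota_uniq _ _) _ => x; rewrite mem_iota add1n ltnS => xk.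
have /forallPn[j] := full x xk; rewrite negb_imply negbK => /andP[gij /eqP cj].
apply/mapP; exists j => //; rewrite mem_enum inE gij andbT.
(* The vertex [j] is not [i] itself: [i] still carries the value 0, while [x] is positive. *)
by apply: contraTneq xk => ji; rewrite -cj ji ci0.
Qed.

Lemma leq_card_bigcup (I V : finType) (P : pred I) (F : I -> {set V}) :
  (#|\bigcup_(i | P i) F i| <= \sum_(i | P i) #|F i|)%N.
Proof.
elim/big_rec2: _ => [|i m A _ le_Am]; first by rewrite cards0.
by rewrite (leq_trans (leq_card_setU _ _)) ?leq_add2l.
Qed.

Lemma square_graph_max_degree (V : finType) (e : rel V) :
  symmetric e -> (max_degree (square_graph e) <= max_degree e ^ 2)%N.
Proof.
move=> e_sym; apply/bigmax_leqP => i _.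
pose nbr v := [set j | (j != v) && e v j].
have nbr_le v : (#|nbr v| <= max_degree e)%N by exact: degree_le_max.
have sub : [set k | (k != i) && square_graph e i k]
    \subset \bigcup_(j in nbr i) (j |: (nbr j :\ i)).
  apply/subsetP => k; rewrite inE /square_graph => /and3P[ki _ eik].
  have [{}eik|neik] := boolP (e i k).
    by apply/bigcupP; exists k; rewrite !inE ?ki ?eqxx.
  move: eik; rewrite (negbTE neik) /= => /existsP[j /andP[eij ejk]].
  (* Self-edges of [e] allow [j = i] a priori, but then [e j k] would be the excluded edge
     [e i k]. *)
  have ji : j != i by apply: contraNneq neik => <-.
  by apply/bigcupP; exists j; rewrite !inE ?ji // ki ejk andbT; case: eqP.
apply: leq_trans (subset_leq_card sub) _.
apply: leq_trans (leq_card_bigcup _ _ _ _) _.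
have bound j : j \in nbr i -> (#|j |: (nbr j :\ i)| <= max_degree e)%N.
  rewrite inE => /andP[ji eij]; apply: leq_trans (nbr_le j).
  (* By symmetry [i] is a neighbor of [j]; its removal pays for the insertion of [j], which keeps
     the bound at [d] instead of [d + 1]. *)
  have inbr : i \in nbr j by rewrite inE eq_sym ji e_sym.
  by rewrite (cardsD1 i (nbr j)) inbr cardsU1 leq_add2r leq_b1.
apply: leq_trans (leq_sum _ bound) _.
by rewrite sum_nat_const expnS expn1 leq_mul2r nbr_le orbT.
Qed.

Lemma training_design_size (N D Tbar K : nat) (col : {ffun 'I_N -> nat}) (T : nat)
    (block : 'I_(num_blocks K D) -> {set 'I_T}) (W : 'I_T -> {ffun 'I_N -> nat}) :
  training_design Tbar col block W -> T = (num_blocks K D * Tbar)%N.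
Proof.
case=> cover disj size _.
rewrite -[LHS]card_ord -cardsT -cover -sum1_card partition_disjoint_bigcup //=.
under eq_bigr do rewrite sum1_card size.
by rewrite sum_nat_const card_ord.
Qed.

Lemma num_blocksE (K D : nat) : (0 < D)%N ->
  (num_blocks K D)%:Z = Num.ceil (K%:R / (D%:R - 1) : rat).
Proof.
move=> D_gt0; rewrite /num_blocks gez0_abs // ceil_ge0.
(* [ceil_ge0] leaves the weaker goal that the quotient exceeds -1. For [D = 1] the quotient is 0 by
   the convention on division by zero. *)
apply: (@lt_le_trans _ _ 0) => //.
by rewrite divr_ge0 ?ler0n // subr_ge0 ler1n.
Qed.

Theorem lemma2 (N D rbar : nat) (e : rel 'I_N)
  (D_ge2 : (2 <= D)%N) (rbar_gt0 : (0 < rbar)%N)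
  (e_refl : reflexive e) (e_sym : symmetric e)
  (NumColors : nat) (Coloring : {ffun 'I_N -> nat})
  (Coloring_greedy : greedy_coloring (square_graph e) Coloring NumColors)
  (Ttr : nat) (block : 'I_(num_blocks NumColors D) -> {set 'I_Ttr})
  (W : 'I_Ttr -> {ffun 'I_N -> nat})
  (design : training_design (rbar * D)%N Coloring block W) :
  [/\ Ttr%:Z = rbar%:Z * D%:Z * Num.ceil (NumColors%:R / (D%:R - 1) : rat),
      (NumColors <= max_degree (square_graph e) + 1)%N
    & (Ttr%:R : rat) <=
        rbar%:R * D%:R * ((max_degree e)%:R ^+ 2 + D%:R) / (D%:R - 1)].
Proof.
have D_gt0 : (0 < D)%N by exact: ltnW.
have Ttr_eq := training_design_size _ _ _ _ _ _ _ _ design.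
have K_le : (NumColors <= max_degree (square_graph e) + 1)%N.
  by rewrite addn1; case: Coloring_greedy => /greedy_run_colors.
split=> //; first by rewrite -num_blocksE // Ttr_eq mulnC !PoszM.
have D1_gt0 : 0 < D%:R - 1 :> rat by rewrite subr_gt0 ltr1n.
rewrite Ttr_eq mulnC !natrM -!mulrA ler_wpM2l // ler_wpM2l //.
have -> : (num_blocks NumColors D)%:R
    = (Num.ceil (NumColors%:R / (D%:R - 1) : rat))%:~R :> rat.
  by rewrite -num_blocksE.
have := ltW (ceilB1_lt (NumColors%:R / (D%:R - 1) : rat)).
rewrite intrB lerBlDr => /le_trans; apply.
(* Writing 1 as [(D - 1) / (D - 1)] gives both sides the same denominator; what remains is
   [K + (D - 1) <= d ^ 2 + D], that is, [K <= d ^ 2 + 1], where [K] is [NumColors]. *)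
rewrite -[X in _ + X](divff (lt0r_neq0 D1_gt0)) -mulrDl.
rewrite ler_pM2r ?invr_gt0 // addrCA [leRHS]addrC lerD2l lerBlDr.
rewrite -natrX natr1 ler_nat -addn1.
by rewrite (leq_trans K_le) // leq_add2r square_graph_max_degree.
Qed.
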